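(* Let $R$ be an integral domain of characteristic zero, $n\ge 1$, $\mathcal{A}_n=R[x_1^{\pm1},\dots,x_n^{\pm1}]$, and let $D$ be an $R$-derivation of $\mathcal{A}_n$. Then: 1) $D$ is locally finite if and only if $D=\sum_{i=1}^n q_i x_i\partial_i$ for some $q_1,\dots,q_n\in R$. 2) $D$ is locally nilpotent if and only if $D=0$; that is, $\mathcal{A}_n$ has no nonzero locally nilpotent $R$-derivations.
   Context: $\mathcal{A}_n=R[x^{-1},x]$ is the Laurent polynomial algebra over $R$ in $n$ commuting free variables $x=(x_1,\dots,x_n)$, and $\partial_i=\partial/\partial x_i$. An $R$-derivation of an $R$-algebra $\mathcal{A}$ is an $R$-linear map $D:\mathcal{A}\to\mathcal{A}$ with $D(ab)=D(a)b+aD(b)$ for all $a,b\in\mathcal{A}$. An $R$-linear endomorphism $\eta$ of $\mathcal{A}$ is locally nilpotent if for each $a\in\mathcal{A}$ there is $m\ge1$ with $\eta^m(a)=0$; it is locally finite if for each $a\in\mathcal{A}$ the $R$-submodule spanned by $\eta^i(a)$ $(i\ge0)$ is finitely generated. *)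

(* Defs.v *)
From HB Require Import structures.
From mathcomp Require Import all_boot all_order all_algebra finmap.
From mathcomp Require Import monalg.

Set Implicit Arguments.
Unset Strict Implicit.
Unset Printing Implicit Defensive.

Import GRing.Theory.

Local Open Scope fset_scope.
Local Open Scope ring_scope.

(* [monalg] equips {malg R[K]} with a product only when K has no invertible
   elements besides 1, which excludes the exponent group Z^n. Its R-module
   structure (finitely supported functions K -> R, with << c *g m >> standing
   for c x^m and f@_m for the coefficient of x^m) is available for every K; the
   Laurent polynomial algebra is this module for K = Z^n with the product
   extending x^a * x^b = x^(a + b). *)
Definition expZ (n : nat) := {ffun 'I_n -> int}.

HB.instance Definition _ n := GRing.Zmodule.on (expZ n).

Definition laurent (R : nzRingType) (n : nat) := {malg R[expZ n]}.

HB.instance Definition _ (R : nzRingType) n := GRing.Lmodule.on (laurent R n).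

Section LaurentRing.
Variables (R : nzRingType) (n : nat).
Implicit Types (f g h : laurent R n) (a b : expZ n) (c : R).

Definition laurent_mul f g : laurent R n :=
  \sum_(a <- msupp f) \sum_(b <- msupp g) << f@_a * g@_b *g a + b >>.

Definition laurent_one : laurent R n := << 1 *g 0 >>.

Lemma laurent_mulw (d1 d2 : {fset expZ n}) f g :
  msupp f `<=` d1 -> msupp g `<=` d2 ->
  laurent_mul f g =
    \sum_(a <- d1) \sum_(b <- d2) << f@_a * g@_b *g a + b >>.
Proof.
move=> le1 le2; rewrite /laurent_mul (big_fset_incl _ le1) /=.
  apply/eq_bigr=> a _; apply/big_fset_incl => // b _ /mcoeff_outdom ->.
  by rewrite mulr0 monalgU0.
move=> a _ /mcoeff_outdom fa.
by rewrite big1 => // b _; rewrite fa mul0r monalgU0.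
Qed.

Lemma laurent_mulUg c a g :
  laurent_mul << c *g a >> g = \sum_(b <- msupp g) << c * g@_b *g a + b >>.
Proof.
rewrite (laurent_mulw msuppU_le (fsubset_refl _)) big_seq_fset1.
by apply/eq_bigr => b _; rewrite mcoeffUU.
Qed.

Lemma laurent_mulgU c b f :
  laurent_mul f << c *g b >> = \sum_(a <- msupp f) << f@_a * c *g a + b >>.
Proof.
rewrite (laurent_mulw (fsubset_refl _) msuppU_le).
by apply/eq_bigr => a _; rewrite big_seq_fset1 mcoeffUU.
Qed.

Lemma laurent_mulUU c c' a b :
  laurent_mul << c *g a >> << c' *g b >> = << c * c' *g a + b >>.
Proof.
by rewrite (laurent_mulw msuppU_le msuppU_le) !big_seq_fset1 !mcoeffUU.
Qed.

Lemma laurent_mul1g : left_id laurent_one laurent_mul.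
Proof.
move=> g; rewrite laurent_mulUg [RHS]monalgE.
by apply/eq_bigr=> b _; rewrite mul1r add0r.
Qed.

Lemma laurent_mulg1 : right_id laurent_one laurent_mul.
Proof.
move=> g; rewrite laurent_mulgU [RHS]monalgE.
by apply/eq_bigr=> b _; rewrite mulr1 addr0.
Qed.

Lemma laurent_mulDl : left_distributive laurent_mul +%R.
Proof.
move=> f g h.
rewrite [X in _ = X + _](laurent_mulw (fsubsetUl _ (msupp g)) (fsubset_refl _)).
rewrite [X in _ = _ + X](laurent_mulw (fsubsetUr (msupp f) _) (fsubset_refl _)).
rewrite (laurent_mulw (msuppD_le _ _) (fsubset_refl _)).
rewrite -big_split /=; apply/eq_bigr=> a _.
rewrite -big_split /=; apply/eq_bigr=> b _.
by rewrite mcoeffD mulrDl monalgUD.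
Qed.

Lemma laurent_mulDr : right_distributive laurent_mul +%R.
Proof.
move=> h f g.
rewrite [X in _ = X + _](laurent_mulw (fsubset_refl _) (fsubsetUl _ (msupp g))).
rewrite [X in _ = _ + X](laurent_mulw (fsubset_refl _) (fsubsetUr (msupp f) _)).
rewrite (laurent_mulw (fsubset_refl _) (msuppD_le _ _)).
rewrite -big_split /=; apply/eq_bigr=> a _.
rewrite -big_split /=; apply/eq_bigr=> b _.
by rewrite mcoeffD mulrDr monalgUD.
Qed.

Lemma laurent_mul0g : left_zero 0 laurent_mul.
Proof. by move=> g; rewrite /laurent_mul msupp0 big_seq_fset0. Qed.

Lemma laurent_mulg0 : right_zero 0 laurent_mul.
Proof.
by move=> g; rewrite /laurent_mul msupp0 big1 // => a _; rewrite big_seq_fset0.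
Qed.

Lemma laurent_mulA : associative laurent_mul.
Proof.
have suml I r (F : I -> laurent R n) g :
    laurent_mul (\sum_(i <- r) F i) g = \sum_(i <- r) laurent_mul (F i) g.
  exact: (big_morph (laurent_mul^~ g) (fun _ _ => laurent_mulDl _ _ _)
            (laurent_mul0g _)).
have sumr I r (F : I -> laurent R n) g :
    laurent_mul g (\sum_(i <- r) F i) = \sum_(i <- r) laurent_mul g (F i).
  exact: (big_morph (laurent_mul g) (fun _ _ => laurent_mulDr _ _ _)
            (laurent_mulg0 _)).
move=> f g h; move: suml sumr laurent_mulUU.
move: laurent_mul => mul suml sumr mulUU.
rewrite (monalgE f) !suml; apply: eq_bigr => a _.
rewrite (monalgE g) !(suml, sumr); apply: eq_bigr => b _.
rewrite (monalgE h) !sumr; apply: eq_bigr => d _.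
by rewrite !mulUU mulrA addrA.
Qed.

Lemma laurent_one_neq0 : laurent_one != 0.
Proof. by rewrite monalgU_eq0 oner_eq0. Qed.

HB.instance Definition _ := GRing.Zmodule_isNzRing.Build (laurent R n)
  laurent_mulA laurent_mul1g laurent_mulg1 laurent_mulDl laurent_mulDr
  laurent_one_neq0.

Lemma laurent_scaleE c f : c *: f = (<< c *g 0 >> : laurent R n) * f.
Proof.
rewrite [RHS]laurent_mulUg; apply/malgP => k; rewrite mcoeffZ raddf_sum /=.
rewrite {1}[f]monalgE raddf_sum mulr_sumr; apply: eq_bigr => b _ /=.
by rewrite !mcoeffU add0r mulrnAr.
Qed.

Lemma laurent_scaleAl c f g : c *: (f * g) = (c *: f) * g.
Proof. by rewrite !laurent_scaleE mulrA. Qed.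

HB.instance Definition _ :=
  GRing.Lmodule_isLalgebra.Build R (laurent R n) laurent_scaleAl.

End LaurentRing.

Lemma laurent_mulC (R : comNzRingType) n : @commutative (laurent R n) _ *%R.
Proof.
move=> f g; rewrite [LHS]/GRing.mul/= [RHS]/GRing.mul/= /laurent_mul.
rewrite exchange_big; apply: eq_bigr => b _; apply: eq_bigr => a _ /=.
by rewrite mulrC addrC.
Qed.

HB.instance Definition _ (R : comNzRingType) n :=
  GRing.PzRing_hasCommutativeMul.Build (laurent R n) (@laurent_mulC R n).

HB.instance Definition _ (R : comNzRingType) n :=
  GRing.Lalgebra_isComAlgebra.Build R (laurent R n).

Definition expZ1 n (i : 'I_n) : expZ n := [ffun j => (i == j)%:Z].

Definition laurentX (R : nzRingType) n (i : 'I_n) : laurent R n :=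
  << 1 *g expZ1 i >>.

Definition laurent_pder (R : nzRingType) n (i : 'I_n) (f : laurent R n) :
    laurent R n :=
  \sum_(a <- msupp f) << (a i)%:~R * f@_a *g a - expZ1 i >>.

Definition derivation (R : nzRingType) (A : algType R) (D : {linear A -> A}) :
    Prop :=
  forall a b : A, D (a * b) = D a * b + a * D b.

Definition in_span (R : pzRingType) (V : lmodType R) (S : V -> Prop) (v : V) :
    Prop :=
  exists (k : nat) (c : 'I_k -> R) (s : 'I_k -> V),
    (forall i, S (s i)) /\ v = \sum_(i < k) c i *: s i.

(* Over a non-Noetherian R the generators have to lie in M; this is implied by
   the equivalence. *)
Definition finitely_generated (R : pzRingType) (V : lmodType R)
    (M : V -> Prop) : Prop :=
  exists (k : nat) (g : 'I_k -> V),
    forall v, M v <-> in_span (fun w => exists i, w = g i) v.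

Definition locally_nilpotent (R : pzRingType) (V : lmodType R)
    (eta : {linear V -> V}) : Prop :=
  forall a : V, exists m : nat, (1 <= m)%N /\ iter m eta a = 0.

Definition locally_finite (R : pzRingType) (V : lmodType R)
    (eta : {linear V -> V}) : Prop :=
  forall a : V,
    finitely_generated (in_span (fun w => exists i : nat, w = iter i eta a)).

(* Main.v *)
(* A derivation acts on monomials by D x^a = sum_b l_b(a) x^(a + b) with each l_b
   additive in a and only finitely many l_b nonzero. Order these b by a linear
   form that separates them and 0, and let b be the dominant one: the
   leading term of D^m x^a is prod_(j < m) l_b(a + j b) x^(a + m b). In
   characteristic zero this is nonzero for all m if a = b when l_b(b) <> 0, and
   if l_b(a) <> 0 when l_b(b) = 0. So D is not locally nilpotent if some l_b is
   nonzero, and not locally finite if some l_b with b <> 0 is (replacing the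
   form by its opposite makes the dominant b nonzero). *)

Require Import Defs.
From HB Require Import structures.
From mathcomp Require Import all_boot all_order all_algebra.
From mathcomp Require Import finmap monalg.

Import Order.TTheory GRing.Theory Num.Theory.
Local Open Scope ring_scope.

(** * Linear forms separating finitely many exponents *)

Lemma exists_nonroot (p : {poly int}) : p != 0 -> exists N : nat, p.[N%:Z] != 0.
Proof.
(* These [size p] distinct candidates are one more than the degree of [p], so they cannot all be
   roots. *)
move=> pN0; pose rs := [seq i%:Z | i <- iota 0 (size p)].
have rs_uniq : uniq rs by rewrite map_inj_uniq ?iota_uniq // => i j [].
have [rs_roots|/allPn[_ /mapP[N _ ->] Np]] := boolP (all (root p) rs).
  by have := max_poly_roots pN0 rs_roots rs_uniq; rewrite size_map size_iota ltnn.
by exists N.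
Qed.

(* The form is t |-> sum_i t_i N^i, with N a non-root of the finitely many
   nonzero polynomials sum_i t_i X^i. *)
Lemma exists_separating_form (n : nat) (T : seq (expZ n)) :
  exists w : {additive expZ n -> int}, {in T, forall t, w t = 0 -> t = 0}.
Proof.
pose p (t : expZ n) : {poly int} :=
  \poly_(k < n) (if insub k is Some i then t i else 0).
have pE t (i : 'I_n) : (p t)`_i = t i by rewrite coef_poly ltn_ord valK.
have p_neq0 (t : expZ n) : t != 0 -> p t != 0.
  apply: contraNneq => pt0; apply/eqP/ffunP => i.
  by rewrite -pE pt0 coef0 ffunE.
have /exists_nonroot[N] : \prod_(t <- T | t != 0) p t != 0.
  by rewrite prodf_seq_neq0; apply/allP => t _; apply/implyP/p_neq0.
rewrite horner_prod prodf_seq_neq0 => /allP TN.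
pose w (t : expZ n) : int := (p t).[N%:Z].
have w_add : zmod_morphism w.
  move=> s t; rewrite /w -hornerN -hornerD; congr (_.[_]).
  apply/polyP => k; rewrite coefB !coef_poly.
  case: ltnP => [kn|]; last by rewrite subr0.
  by rewrite insubT !ffunE.
pose W : {additive expZ n -> int} :=
  HB.pack w (GRing.isZmodMorphism.Build _ _ w w_add).
exists W => t tT wt0; apply/eqP; apply: contraTT (TN t tT) => tN0.
by rewrite tN0 /= negbK; apply/eqP.
Qed.

(** * Spans in modules *)

Lemma in_span_mem (R : pzRingType) (V : lmodType R) (S : V -> Prop) (v : V) :
  S v -> in_span S v.
Proof.
by move=> Sv; exists 1%N, (fun=> 1), (fun=> v); rewrite big_ord1 scale1r.
Qed.

Lemma in_spanZ (R : pzRingType) (V : lmodType R) (S : V -> Prop) (a : R) (v : V) :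
  in_span S v -> in_span S (a *: v).
Proof.
move=> [k [c [s [Ss ->]]]]; exists k, (fun i => a * c i), s; split=> //.
by rewrite scaler_sumr; apply: eq_bigr => i _; rewrite scalerA.
Qed.

Lemma in_spanD (R : pzRingType) (V : lmodType R) (S : V -> Prop) (u v : V) :
  in_span S u -> in_span S v -> in_span S (u + v).
Proof.
move=> [k [c [s [Ss ->]]]] [l [d [t [St ->]]]].
exists (k + l)%N, (fun i => match split i with inl j => c j | inr j => d j end),
  (fun i => match split i with inl j => s j | inr j => t j end).
split=> [i|]; first by case: split.
rewrite big_split_ord /=; congr (_ + _); apply: eq_bigr => i _.
  by rewrite (unsplitK (inl i)).
by rewrite (unsplitK (inr i)).
Qed.

Lemma in_span_sub (R : pzRingType) (V : lmodType R) (S T : V -> Prop) (v : V) :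
  (forall s, S s -> in_span T s) -> in_span S v -> in_span T v.
Proof.
move=> ST [k [c [s [Ss ->]]]]; elim/big_ind: _ => [|u w|i _].
- by exists 0%N, (fun=> 0), (fun=> 0); split=> [[]//|]; rewrite big_ord0.
- exact: in_spanD.
- by apply/in_spanZ/ST.
Qed.

(** * Coefficients of linear maps and Euler operators *)

(* For a derivation D this is the value at a of the additive map l_b in the
   decomposition D x^a = sum_b l_b(a) x^(a + b). *)
Definition shift_coef {R : nzRingType} {n : nat}
    (D : laurent R n -> laurent R n) (b a : expZ n) : R :=
  (D << 1 *g a >>)@_(a + b).

Lemma mcoeff_linear (R : nzRingType) (n : nat)
    (D : {linear laurent R n -> laurent R n}) (f : laurent R n) (c : expZ n) :
  (D f)@_c = \sum_(a <- msupp f) f@_a * shift_coef D (c - a) a.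
Proof.
rewrite {1}[f]monalgE raddf_sum raddf_sum /=; apply: eq_bigr => a _.
have -> : << f@_a *g a >> = f@_a *: (<< 1 *g a >> : laurent R n).
  by apply/malgP => k; rewrite mcoeffZ !mcoeffU mulrnAr mulr1.
by rewrite linearZ mcoeffZ /shift_coef addrC subrK.
Qed.

Lemma mcoeff_mulX (R : nzRingType) (n : nat) (f : laurent R n) (a c : expZ n) :
  (f * (<< 1 *g a >> : laurent R n))@_(c + a) = f@_c.
Proof.
rewrite [_ * _]laurent_mulgU raddf_sum [in RHS](monalgE f) raddf_sum /=.
by apply: eq_bigr => b _; rewrite !mcoeffU mulr1 (inj_eq (addIr a)).
Qed.

Lemma mcoeff_laurentX_pder (R : comNzRingType) (n : nat) (i : 'I_n)
    (f : laurent R n) (c : expZ n) :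
  (laurentX R i * laurent_pder i f)@_c = (c i)%:~R * f@_c.
Proof.
rewrite mulrC -[c in LHS](subrK (expZ1 i)) mcoeff_mulX raddf_sum /=.
rewrite [in RHS](monalgE f) raddf_sum mulr_sumr; apply: eq_bigr => a _ /=.
rewrite !mcoeffU (inj_eq (addIr _)); have [->//|_] := eqVneq a c.
by rewrite !mulr0n mulr0.
Qed.

(** * The additive maps l_b of a derivation *)

Section Derivation.
Variables (R : idomainType) (n : nat) (D : {linear laurent R n -> laurent R n}).
Hypothesis D_der : derivation D.

(** Apply the Leibniz rule to x^a x^a' and compare coefficients at x^(a + a' + b). *)
Lemma shift_coefD (b a a' : expZ n) :
  shift_coef D b (a + a') = shift_coef D b a + shift_coef D b a'.
Proof.
rewrite /shift_coef.
have -> : << 1 *g a + a' >>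
    = (<< 1 *g a >> : laurent R n) * (<< 1 *g a' >> : laurent R n).
  by rewrite [RHS]laurent_mulUU mulr1.
rewrite D_der mcoeffD; congr (_ + _); first by rewrite addrAC mcoeff_mulX.
by rewrite -addrA [a + _]addrC mulrC mcoeff_mulX.
Qed.

Lemma shift_coef_zmod_morphism (b : expZ n) : zmod_morphism (shift_coef D b).
Proof.
by move=> a a'; apply/eqP; rewrite -subr_eq opprK -shift_coefD subrK.
Qed.

HB.instance Definition _ (b : expZ n) :=
  GRing.isZmodMorphism.Build _ _ (shift_coef D b) (shift_coef_zmod_morphism b).

Lemma shift_coefE (b a : expZ n) :
  shift_coef D b a = \sum_(i < n) (a i)%:~R * shift_coef D b (expZ1 i).
Proof.
have {1}-> : a = \sum_(i < n) expZ1 i *~ a i.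
  apply/ffunP => j.
  have ffunMz (t : expZ n) (m : int) : (t *~ m) j = t j * m.
    by rewrite -mulrzz; case: m => m; rewrite ?NegzE ?mulrNz ?ffunE -!pmulrn ffunMnE.
  rewrite sum_ffunE (bigD1 j) //= big1 ?addr0 => [|i ij].
    by rewrite ffunMz ffunE eqxx mul1r.
  by rewrite ffunMz ffunE (negPf ij) mul0r.
by rewrite raddf_sum; apply: eq_bigr => i _ /=; rewrite raddfMz mulrzl.
Qed.

(** By additivity a nonzero l_b is nonzero at some [expZ1 i], so x^b x_i occurs in D x_i; only
    finitely many b are possible. *)
Lemma shift_coef_finite_support :
  exists S : seq (expZ n), forall b, b \in S <-> exists a, shift_coef D b a != 0.
Proof.
pose T := flatten [seq [seq c - expZ1 i | c <- msupp (D (laurentX R i))]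
                  | i <- enum 'I_n].
exists [seq b <- T | [exists i, shift_coef D b (expZ1 i) != 0]] => b.
rewrite mem_filter; split=> [/andP[/existsP[i bi] _]|[a ba]].
  by exists (expZ1 i).
have /existsP[i bi] : [exists i, shift_coef D b (expZ1 i) != 0].
  apply: contraNT ba => /existsPn b0; rewrite shift_coefE big1 // => i _.
  by have := b0 i; rewrite negbK => /eqP ->; rewrite mulr0.
apply/andP; split; first by apply/existsP; exists i.
apply/flatten_mapP; exists i; first by rewrite mem_enum.
apply/mapP; exists (expZ1 i + b); last by rewrite addrC addKr.
by rewrite -mcoeff_neq0.
Qed.

Lemma mcoeff_linear_neq0 (f : laurent R n) (c : expZ n) :
  (D f)@_c != 0 -> exists2 d, f@_d != 0 & shift_coef D (c - d) d != 0.
Proof.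
rewrite mcoeff_linear => Dfc.
have /hasP[d _] : has (fun d => f@_d * shift_coef D (c - d) d != 0) (msupp f).
  apply: contraNT Dfc => /hasPn no; rewrite big_seq big1 // => d /no.
  by rewrite negbK => /eqP.
by rewrite mulf_eq0 negb_or => /andP[]; exists d.
Qed.

(** * Leading terms of the iterates *)

Section Dominant.
Variables (w : {additive expZ n -> int}) (b : expZ n).
Hypothesis b_dominant :
  forall b' a', shift_coef D b' a' != 0 -> b' = b \/ w b' < w b.

(** Each application of D moves an exponent by some shift, and every shift other than b raises [w]
    by less than [w b]. *)
Lemma iter_dominant (a : expZ n) (m : nat) (c : expZ n) :
  (iter m D << 1 *g a >>)@_c != 0 -> c = a + b *+ m \/ w c < w (a + b *+ m).
Proof.
elim: m c => [|m IHm] c /=.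
  by rewrite mcoeffU mulr0n addr0; case: (eqVneq a c) => [->|_]; [left|rewrite eqxx].
move=> /mcoeff_linear_neq0[d /IHm dm /b_dominant cd].
have -> : c = (c - d) + d by rewrite subrK.
move: (c - d) cd => e; rewrite mulrS addrCA.
rewrite (raddfD w b) (raddfD w e).
case: dm => [->|dm] [->|eb]; first by left.
- by right; rewrite ltrD2r.
- by right; rewrite ltrD2l.
- by right; rewrite ltrD.
Qed.

(** The only path from a to a + m b in m steps takes the shift b every time, so no other terms can
    cancel this product. *)
Lemma iter_dominant_mcoeff (a : expZ n) (m : nat) :
  (iter m D << 1 *g a >>)@_(a + b *+ m) =
  \prod_(j < m) shift_coef D b (a + b *+ j).
Proof.
elim: m => [|m IHm]; first by rewrite big_ord0 /= mulr0n addr0 mcoeffUU.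
rewrite big_ord_recr -IHm /= mcoeff_linear; set f := iter m D _.
set d0 := a + b *+ m.
have -> : a + b *+ m.+1 = b + d0 by rewrite mulrS addrCA.
(* Any other d in the support of [f] has [w d < w d0], so reaching b + d0 from it would take a shift
   of weight above [w b]. *)
have others0 d : d != d0 -> f@_d * shift_coef D (b + d0 - d) d = 0.
  move=> dN; apply/eqP/negPn; rewrite mulf_eq0 negb_or; apply/negP => /andP[].
  move=> /iter_dominant[/eqP|]; first by rewrite (negPf dN).
  rewrite -/d0 => wd /b_dominant; rewrite -addrA; case=> [/eqP|].
    by rewrite -subr_eq0 addrAC subrr add0r subr_eq0 eq_sym (negPf dN).
  by rewrite raddfD gtrDl raddfB subr_lt0 ltNge ltW.
have [d0f|] := boolP (d0 \in msupp f).
  rewrite (bigD1_seq d0) ?fset_uniq //= addrK big1 ?addr0 //.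
rewrite -mcoeff_eq0 => /eqP fd0; rewrite fd0 mul0r big1_seq // => d _.
by have [->|/others0//] := eqVneq d d0; rewrite fd0 mul0r.
Qed.

End Dominant.

(** Nonvanishing iterates refute local nilpotence; with b nonzero they also involve infinitely many
    exponents, which refutes local finiteness. *)
Lemma exists_iter_mcoeff_neq0 (b0 a0 : expZ n) :
  [pchar R] =i pred0 -> shift_coef D b0 a0 != 0 ->
  exists a b : expZ n, (b0 != 0 -> b != 0) /\
    forall m : nat, (iter m D << 1 *g a >>)@_(a + b *+ m) != 0.
Proof.
move=> /pcharf0P char0 b0a0; have [S SE] := shift_coef_finite_support.
have b0S : b0 \in S by apply/SE; exists a0.
(* A form vanishing on no nonzero difference is injective on [0 :: S]. *)
pose T := [seq s - t | s <- 0 :: S, t <- 0 :: S].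
have [w [w_inj wb0]] : exists w : {additive expZ n -> int},
    {in 0 :: S &, injective w} /\ 0 <= w b0.
  have [w wT] := exists_separating_form _ T.
  have w_inj : {in 0 :: S &, injective w}.
    move=> s t sS tS /eqP; rewrite -subr_eq0 -raddfB => /eqP /wT st.
    by apply/eqP; rewrite -subr_eq0 st //; apply/allpairsP; exists (s, t).
  have [wb0|wb0] := leP 0 (w b0); first by exists w.
  pose w' : {additive expZ n -> int} := -%R \o w.
  exists w'; split=> [s t sS tS /oppr_inj|]; first exact: w_inj.
  by rewrite oppr_ge0 ltW.
have [b bS b_max] : exists2 b, b \in S & forall b', b' \in S -> w b' <= w b.
  case: (arg_maxP (P := xpredT) (fun s : seq_sub S => w (val s))
    (i0 := SeqSub b0S) isT) => b _ b_max.
  by exists (val b) => [|b' b'S]; [exact: valP|exact: (b_max (SeqSub b'S))].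
have b_dominant b' a' : shift_coef D b' a' != 0 -> b' = b \/ w b' < w b.
  move=> b'a'; have b'S : b' \in S by apply/SE; exists a'.
  rewrite lt_neqAle b_max // andbT.
  have [wE|_] := eqVneq (w b') (w b); last by right.
  by left; apply: w_inj; rewrite // inE ?b'S ?bS orbT.
have [a a_neq0] : exists a, forall m, shift_coef D b (a + b *+ m) != 0.
  (* For a = b the value is (m + 1) l_b(b); if l_b(b) = 0, then l_b is constant along a + m b. *)
  have [bb0|bb] := eqVneq (shift_coef D b b) 0; last first.
    by exists b => m; rewrite -mulrS raddfMn -mulr_natr mulf_neq0 // char0.
  have /SE[a ba] := bS; exists a => m.
  by rewrite raddfD raddfMn /= bb0 mul0rn addr0.
exists a, b; split=> [b0N|m]; last first.
  by rewrite (iter_dominant_mcoeff w) //; apply/prodf_neq0 => j _.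
(* If b = 0, maximality and the sign of [w b0] force [w b0 = w 0], hence b0 = 0. *)
apply: contraNneq b0N => b_eq0; apply/eqP/w_inj; rewrite ?inE ?b0S ?eqxx ?orbT //.
by apply/eqP; rewrite eq_le raddf0 wb0 andbT -(raddf0 w) -b_eq0 b_max.
Qed.

(** * Vanishing of the l_b *)

Lemma locally_nilpotent_shift_coef (b a : expZ n) :
  [pchar R] =i pred0 -> locally_nilpotent D -> shift_coef D b a = 0.
Proof.
move=> char0 Dnil; apply/eqP/negPn/negP => /(exists_iter_mcoeff_neq0 _ _ char0).
move=> [a' [b' [_ neq0]]]; have [m [_ Dm]] := Dnil << 1 *g a' >>.
by have := neq0 m; rewrite Dm mcoeff0 eqxx.
Qed.

Lemma locally_finite_shift_coef (b a : expZ n) :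
  [pchar R] =i pred0 -> locally_finite D -> b != 0 -> shift_coef D b a = 0.
Proof.
move=> char0 Dfin bN0; apply/eqP/negPn/negP => /(exists_iter_mcoeff_neq0 _ _ char0).
move=> [a' [b' [/(_ bN0) b'N0 iter_neq0]]].
have [k [g gE]] := Dfin << 1 *g a' >>.
(* All exponents of the generators; being combinations of these, the iterates have no others. *)
pose F := flatten [seq (msupp (g i) : seq (expZ n)) | i <- enum 'I_k].
have iterF m : a' + b' *+ m \in F.
  have [l [c [s [sg Dm]]]] : in_span (fun v => exists i, v = g i)
      (iter m D << 1 *g a' >>).
    by apply/gE; apply: in_span_mem; exists m.
  apply: contraNT (iter_neq0 m) => notF; rewrite Dm raddf_sum big1 // => i _ /=.
  have [j ->] := sg i; rewrite mcoeffZ mcoeff_outdom ?mulr0 //.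
  by apply: contra notF => mj; apply/flatten_mapP; exists j; rewrite ?mem_enum.
(* Pigeonhole: a nonzero coordinate of b' makes these exponents distinct, and there is one more of
   them than [F] has entries. *)
have exps_uniq : uniq [seq a' + b' *+ m | m <- iota 0 (size F).+1].
  rewrite map_inj_uniq ?iota_uniq // => m m' /addrI /ffunP b'mm'.
  have /existsP[i b'i] : [exists i, b' i != 0].
    apply: contraNT b'N0 => /existsPn b'0; apply/eqP/ffunP => i; rewrite ffunE.
    by apply/eqP; rewrite -[_ == _]negbK b'0.
  by apply: (mulrIn b'i); have := b'mm' i; rewrite !ffunMnE.
have : ((size F).+1 <= size F)%N; last by rewrite ltnn.
rewrite -[X in (X <= _)%N](size_iota 0) -(size_map (fun m => a' + b' *+ m)).
by apply: uniq_leq_size => // _ /mapP[m _ ->].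
Qed.

(** * Diagonal derivations *)

Lemma mcoeff_diagonal (f : laurent R n) (c : expZ n) :
  (forall b a, b != 0 -> shift_coef D b a = 0) ->
  (D f)@_c = shift_coef D 0 c * f@_c.
Proof.
move=> diag; have others0 d : d != c -> f@_d * shift_coef D (c - d) d = 0.
  by move=> dc; rewrite diag ?mulr0 // subr_eq0 eq_sym.
rewrite mcoeff_linear mulrC; have [cf|] := boolP (c \in msupp f).
  by rewrite (bigD1_seq c) ?fset_uniq //= subrr big1 ?addr0.
rewrite -mcoeff_eq0 => /eqP fc0; rewrite fc0 mul0r big1_seq // => d _.
by have [->|/others0//] := eqVneq d c; rewrite fc0 mul0r.
Qed.

(** Both sides scale x^c by l_0(c), since l_0 is additive and l_0([expZ1 i]) is the eigenvalue of D
    at x_i. *)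
Lemma diagonal_euler (f : laurent R n) :
  (forall b a, b != 0 -> shift_coef D b a = 0) ->
  D f = \sum_(i < n) shift_coef D 0 (expZ1 i) *: (laurentX R i * laurent_pder i f).
Proof.
move=> diag; apply/malgP => c; rewrite mcoeff_diagonal // shift_coefE raddf_sum /=.
rewrite mulr_suml; apply: eq_bigr => i _.
by rewrite mcoeffZ mcoeff_laurentX_pder mulrCA mulrA.
Qed.

End Derivation.

(* Each D^k f with k >= size p is a combination of lower iterates: divide X^k by
   the monic p = prod_(c in supp f) (X - l c), which annihilates D on f. *)
Lemma diagonal_locally_finite (R : comNzRingType) (n : nat)
    (D : {linear laurent R n -> laurent R n}) (l : expZ n -> R) :
  (forall f c, (D f)@_c = l c * f@_c) -> locally_finite D.
Proof.
move=> DE f; pose p := \prod_(c <- msupp f) ('X - (l c)%:P).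
have p_monic : p \is monic by apply: monic_prod_XsubC.
have iterE k c : (iter k D f)@_c = l c ^+ k * f@_c.
  by elim: k => [|k IHk] /=; rewrite ?mul1r // DE IHk exprS mulrA.
exists (size p), (fun i => iter i D f) => v; split; apply: in_span_sub => w [k ->].
  pose r := Pdiv.CommonRing.rmodp 'X^k p.
  exists (size p), (fun j => r`_j), (fun j => iter j D f).
  split; first by move=> j; exists j.
  apply/malgP => c; rewrite iterE raddf_sum /=.
  under eq_bigr do rewrite mcoeffZ iterE mulrA.
  rewrite -mulr_suml -horner_coef_wide; last first.
    by apply/ltnW/Pdiv.Ring.ltn_rmodpN0/monic_neq0.
  have [cf|/mcoeff_outdom ->] := boolP (c \in msupp f); last by rewrite !mulr0.
  rewrite -[in LHS]hornerXn (Pdiv.RingMonic.rdivp_eq p_monic 'X^k).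
  rewrite hornerD hornerM.
  suff -> : p.[l c] = 0 by rewrite mulr0 add0r.
  by rewrite /p (big_fsetD1 c) //= hornerM hornerXsubC subrr mul0r.
by apply: in_span_mem; exists k.
Qed.

Theorem proposition2p1 (R : idomainType) (char0 : [pchar R] =i pred0)
    (n : nat) (n_ge1 : (1 <= n)%N)
    (D : {linear laurent R n -> laurent R n}) (D_der : derivation D) :
  (locally_finite D <->
     exists q : 'I_n -> R, forall f : laurent R n,
       D f = \sum_(i < n) q i *: (laurentX R i * laurent_pder i f))
  /\
  (locally_nilpotent D <-> forall f : laurent R n, D f = 0).
Proof.
split; [split=> [Dfin|[q qE]] | split=> [Dnil f|D0 f]].
- exists (fun i => shift_coef D 0 (expZ1 i)) => f.
  apply: diagonal_euler => // b a.
  exact: locally_finite_shift_coef.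
(* The eigenvalue at x^c of the sum of the q_i x_i d/dx_i is the sum of the c_i q_i. *)
- apply: (@diagonal_locally_finite _ _ _ (fun c => \sum_(i < n) (c i)%:~R * q i)).
  move=> f c; rewrite qE raddf_sum mulr_suml; apply: eq_bigr => i _ /=.
  by rewrite mcoeffZ mcoeff_laurentX_pder mulrCA mulrA.
(* Local nilpotence kills every l_b, including l_0, and these determine D. *)
- apply/malgP => c; rewrite mcoeff_linear mcoeff0 big1 // => a _.
  by rewrite locally_nilpotent_shift_coef ?mulr0.
- by exists 1%N; rewrite /= D0.
Qed.
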